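(* (The Chain Theorem) If $\tau\in\Delta_c$ is an associated set of $IP_{A,c}$ and $|\tau|<d$, then there exists a face $\tau'\in\Delta_c$ that is also an associated set of $IP_{A,c}$ with the property that $\tau\subset\tau'$ and $|\tau'\setminus\tau|=1$.
   Context: $\mathbb{N}$ denotes the non-negative integers. $A \in \mathbb{Z}^{d\times n}$ is a fixed matrix of rank $d$ with columns $a_1,\dots,a_n$; $\mathrm{cone}(A)=\{Au : u\in\mathbb{R}^n, u\ge 0\}$ is pointed and $\{u\in\mathbb{R}^n: Au=0, u\ge 0\}=\{0\}$; $\mathbb{N}A=\{Au: u\in\mathbb{N}^n\}$. For $b\in\mathbb{N}A$, $IP_{A,c}(b)$ is the program $\min\{c\cdot x: Ax=b, x\in\mathbb{N}^n\}$; $IP_{A,c}$ is the family of these programs. The cost vector $c\in\mathbb{Z}^n$ is generic, i.e. each $IP_{A,c}(b)$, $b\in\mathbb{N}A$, has a unique optimal solution. For $\sigma\subseteq\{1,\dots,n\}$, $\bar\sigma$ is the complement, $A_\sigma$ the submatrix of columns indexed by $\sigma$, $x_\sigma$ the subvector indexed by $\sigma$. The regular triangulation $\Delta_c$ is the set of all $\sigma\subseteq\{1,\dots,n\}$ for which there is $y\in\mathbb{R}^d$ with $y\cdot a_j=c_j$ for $j\in\sigma$ and $y\cdot a_j<c_j$ for $j\notin\sigma$; its elements are called faces (by genericity, they label a complex of simplicial cones $\mathrm{cone}(A_\sigma)$ with support $\mathrm{cone}(A)$, whose maximal faces have $d$ elements). Group relaxation: for $\tau\in\Delta_c$ and $b\in\mathbb{N}A$,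 $G^\tau(b)$ is the program $\min\{\tilde c_{\bar\tau}\cdot x_{\bar\tau}: A_\tau x_\tau+A_{\bar\tau}x_{\bar\tau}=b,\ x_{\bar\tau}\ge 0,\ (x_\tau,x_{\bar\tau})\in\mathbb{Z}^n\}$, where $\tilde c_{\bar\tau}$ consists of the coordinates indexed by $\bar\tau$ of $c-c_\sigma A_\sigma^{-1}A$ for any maximal face $\sigma\supseteq\tau$ of $\Delta_c$. $G^\tau(b)$ solves $IP_{A,c}(b)$ if its (unique) optimal solution $x^*\in\mathbb{Z}^n$ is non-negative (equivalently, equals the optimal solution of $IP_{A,c}(b)$). Associated set: a face $\tau\in\Delta_c$ such that for some $b\in\mathbb{N}A$, $G^\tau(b)$ solves $IP_{A,c}(b)$ but $G^{\tau'}(b)$ does not, for every face $\tau'\in\Delta_c$ with $\tau\subsetneq\tau'$. *)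

(* Defs.v *)
From HB Require Import structures.
From mathcomp Require Import all_boot all_order all_algebra.
From mathcomp Require Import boolp reals.

Set Implicit Arguments.
Unset Strict Implicit.
Unset Printing Implicit Defensive.

Import Order.TTheory GRing.Theory Num.Theory.
Local Open Scope ring_scope.

Definition nonneg (K : numDomainType) (m : nat) (u : 'cV[K]_m) : Prop :=
  forall i, 0 <= u i 0.

Definition minimizer (T : Type) (K : numDomainType)
    (feasible : T -> Prop) (f : T -> K) (x : T) : Prop :=
  feasible x /\ forall z, feasible z -> f x <= f z.

Definition toR (R : realType) (m n : nat) (M : 'M[int]_(m, n)) : 'M[R]_(m, n) :=
  map_mx intr M.

Definition cone (R : realType) (d n : nat) (A : 'M[int]_(d, n))
    (v : 'cV[R]_d) : Prop :=
  exists2 u : 'cV[R]_n, nonneg u & v = toR R A *m u.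

Definition pointed (R : realType) (d : nat) (C : 'cV[R]_d -> Prop) : Prop :=
  forall v, C v -> C (- v) -> v = 0.

Definition semigroup (d n : nat) (A : 'M[int]_(d, n)) (b : 'cV[int]_d) : Prop :=
  exists2 u : 'cV[int]_n, nonneg u & b = A *m u.

Definition IP_feasible (d n : nat) (A : 'M[int]_(d, n)) (b : 'cV[int]_d)
    (x : 'cV[int]_n) : Prop :=
  A *m x = b /\ nonneg x.

Definition IP_optimal (d n : nat) (A : 'M[int]_(d, n)) (c : 'rV[int]_n)
    (b : 'cV[int]_d) (x : 'cV[int]_n) : Prop :=
  minimizer (IP_feasible A b) (fun z => (c *m z) 0 0) x.

Definition generic (d n : nat) (A : 'M[int]_(d, n)) (c : 'rV[int]_n) : Prop :=
  forall b, semigroup A b -> exists! x, IP_optimal A c b x.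

Definition triangulation (R : realType) (d n : nat) (A : 'M[int]_(d, n))
    (c : 'rV[int]_n) : {set {set 'I_n}} :=
  [set sigma : {set 'I_n} | `[< exists y : 'rV[R]_d, forall j : 'I_n,
     if j \in sigma then (y *m toR R A) 0 j = toR R c 0 j
     else (y *m toR R A) 0 j < toR R c 0 j >]].

Definition maximal_face (R : realType) (d n : nat) (A : 'M[int]_(d, n))
    (c : 'rV[int]_n) (sigma : {set 'I_n}) : Prop :=
  maxset [in triangulation R A c] sigma.

Definition cols (K : Type) (m n : nat) (s : {set 'I_n}) (M : 'M[K]_(m, n)) :
    'M[K]_(m, #|s|) :=
  colsub (fun k : 'I_#|s| => enum_val k) M.

(* c - c_sigma A_sigma^-1 A.  The submatrix A_sigma has type 'M_(d, #|sigma|);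
   for a maximal face of the triangulation of a generic c it is square and
   invertible, and then pinvmx is the inverse (pinvmxE), without a cast along
   #|sigma| = d. *)
Definition reduced_cost (R : realType) (d n : nat) (A : 'M[int]_(d, n))
    (c : 'rV[int]_n) (sigma : {set 'I_n}) : 'rV[R]_n :=
  toR R c - cols sigma (toR R c) *m pinvmx (cols sigma (toR R A)) *m toR R A.

Definition group_feasible (d n : nat) (A : 'M[int]_(d, n)) (tau : {set 'I_n})
    (b : 'cV[int]_d) (x : 'cV[int]_n) : Prop :=
  A *m x = b /\ forall j, j \notin tau -> 0 <= x j 0.

Definition group_optimal (R : realType) (d n : nat) (A : 'M[int]_(d, n))
    (c : 'rV[int]_n) (sigma tau : {set 'I_n}) (b : 'cV[int]_d)
    (x : 'cV[int]_n) : Prop :=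
  minimizer (group_feasible A tau b)
    (fun z => \sum_(j in ~: tau) reduced_cost R A c sigma 0 j * (z j 0)%:~R) x.

(* The optimal solutions do not depend on the maximal face sigma containing
   tau, and such a sigma always exists when tau is a face, so quantifying
   universally or existentially over sigma gives the same notion. *)
Definition group_solves (R : realType) (d n : nat) (A : 'M[int]_(d, n))
    (c : 'rV[int]_n) (tau : {set 'I_n}) (b : 'cV[int]_d) : Prop :=
  forall sigma, maximal_face R A c sigma -> tau \subset sigma ->
    exists2 x, unique (group_optimal R A c sigma tau b) x & nonneg x.

Definition associated (R : realType) (d n : nat) (A : 'M[int]_(d, n))
    (c : 'rV[int]_n) (tau : {set 'I_n}) : Prop :=
  tau \in triangulation R A c /\
  exists b : 'cV[int]_d,
    [/\ semigroup A b,
        group_solves R A c tau b &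
        forall tau', tau' \in triangulation R A c -> tau \proper tau' ->
          ~ group_solves R A c tau' b].

(* Main.v *)
Require Import Defs.
From mathcomp Require Import all_boot all_order all_algebra.
From mathcomp Require Import boolp reals.
Import Order.TTheory GRing.Theory Num.Theory.
Local Open Scope ring_scope.

(** The proof compares the costs of the optimal solutions of the group
    relaxations obtained by dropping one more non-negativity constraint.

    On the fiber of [b] the objective of [G^tau(b)] differs from [c . x] by a
    constant, because the reduced costs vanish on the maximal face used to
    define them.  So [G^tau(b)] is the problem of minimizing [c . x] over the
    integer points of the fiber that are non-negative off [tau]
    ([group_solvesP]).  For a face [tau] an optimum exists, the certificate of
    the face bounding the integer costs from below ([face_group_minimizer]);
    it is unique by genericity ([group_minimizer_unique]), and the whole
    problem is equivariant under translations along [tau]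
    ([group_minimizer_shift]).

    Let [u] be the optimum of [G^tau(b)] for a [b] that shows [tau] to be
    associated.  For every [i] outside [tau] such that [tau + i] is a face,
    let [x i] be the optimum of [G^(tau + i)(b)].  Its coordinate [i] is
    negative, since otherwise it would be [u] and [tau + i] would solve [b].
    As [A] has rank [d] and [tau] has fewer than [d] elements, there is such an
    [i] ([face_extension]); take one for which the cost of [x i] is largest, and
    translate [x i] along [tau + i] to a non-negative point [v].  Then
    [tau + i] solves the fiber of [v].  Suppose that a larger face [sigma] did
    so too, and pick [j] in [sigma] outside [tau + i].  Then [tau + j] is a
    face ([subface]), so that [x j] exists.  It is feasible for the relaxation
    along [sigma], where [x i] would be optimal, and by the choice of [i] it
    costs at most as much as [x i]; hence [x j = x i].  But [x j] is negative
    at [j] and [x i] is not.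

    The two facts on the triangulation rest on the linear independence of the
    columns in a face ([face_cols_full]), which is again uniqueness of optima:
    an integer relation [z] between these columns would be, like [0], an
    optimum of the relaxation with right-hand side [0]. *)

Set Implicit Arguments.
Unset Strict Implicit.
Unset Printing Implicit Defensive.

(** * Group relaxations with the original cost *)

Definition cost (n : nat) (c : 'rV[int]_n) (x : 'cV[int]_n) : int :=
  (c *m x) 0 0.

Definition group_minimizer (d n : nat) (A : 'M[int]_(d, n)) (c : 'rV[int]_n)
    (tau : {set 'I_n}) (b : 'cV[int]_d) : 'cV[int]_n -> Prop :=
  minimizer (group_feasible A tau b) (cost c).

Definition supported (n : nat) (s : {set 'I_n}) (w : 'cV[int]_n) : Prop :=
  forall j, j \notin s -> w j 0 = 0.

Lemma costD n (c : 'rV[int]_n) x w : cost c (x + w) = cost c x + cost c w.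
Proof. by rewrite /cost mulmxDr mxE. Qed.

Lemma costN n (c : 'rV[int]_n) w : cost c (- w) = - cost c w.
Proof. by rewrite /cost mulmxN mxE. Qed.

Lemma cost_0 n (c : 'rV[int]_n) : cost c 0 = 0.
Proof. by rewrite /cost mulmx0 mxE. Qed.

Lemma group_feasible_shift d n (A : 'M[int]_(d, n)) tau b x w :
  supported tau w ->
  group_feasible A tau b x -> group_feasible A tau (b + A *m w) (x + w).
Proof.
move=> sw [<- x0]; split=> [|j jt]; first by rewrite mulmxDr.
by rewrite mxE sw // addr0 x0.
Qed.

(** Translation by [w] maps the feasible set for [b] onto the feasible set for
    [b + A w] and changes all costs by the same amount. *)
Lemma group_minimizer_shift d n (A : 'M[int]_(d, n)) c tau b x w :
  supported tau w ->
  group_minimizer A c tau b x -> group_minimizer A c tau (b + A *m w) (x + w).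
Proof.
move=> sw [fx mx]; split=> [|z fz]; first exact: group_feasible_shift.
have sNw : supported tau (- w) by move=> j jt; rewrite mxE sw ?oppr0.
have := group_feasible_shift sNw fz.
rewrite mulmxN addrK => /mx; rewrite !costD costN => le_x.
by rewrite -lerBrDr.
Qed.

(** Adding [abs_on s x] to [x] is the translation along [s] used to repair the
    coordinates of [x] whose sign is not constrained. *)
Definition abs_on (n : nat) (s : {set 'I_n}) (x : 'cV[int]_n) : 'cV[int]_n :=
  \col_j (if j \in s then `|x j 0| else 0).

Lemma supported_abs_on n s (x : 'cV[int]_n) : supported s (abs_on s x).
Proof. by move=> j /negbTE jt; rewrite mxE jt. Qed.

Lemma nonneg_abs_on n s (x : 'cV[int]_n) : nonneg (abs_on s x).
Proof. by move=> j; rewrite mxE; case: ifP. Qed.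

Lemma nonneg_add_abs_on d n (A : 'M[int]_(d, n)) tau b x :
  group_feasible A tau b x -> nonneg (x + abs_on tau x).
Proof.
case=> _ x0 j; rewrite !mxE; case: ifPn => [_|/x0]; last by rewrite addr0.
by rewrite -lerBlDl sub0r -normrN ler_norm.
Qed.

Lemma group_minimizer_IP_optimal d n (A : 'M[int]_(d, n)) c tau b x :
  group_minimizer A c tau b x -> nonneg x -> IP_optimal A c b x.
Proof.
move=> [[Ax _] mx] x0; split=> [//|z [Az z0]].
by apply: mx; split=> // j _; apply: z0.
Qed.

(** Two optima can be translated along [tau] to non-negative points by the same
    vector; they are then optimal for one integer program, which has a single
    optimum by genericity. *)
Lemma group_minimizer_unique d n (A : 'M[int]_(d, n)) c tau b x x' :
  generic A c -> group_minimizer A c tau b x -> group_minimizer A c tau b x' ->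
  x = x'.
Proof.
move=> genc mx mx'; set w := abs_on tau x + abs_on tau x'.
have sw : supported tau w.
  by move=> j jt; rewrite mxE !supported_abs_on // addr0.
have pos a v : group_feasible A tau b a -> nonneg v ->
    nonneg (a + abs_on tau a + v).
  by move=> fa v0 j; rewrite mxE addr_ge0 ?v0 // (nonneg_add_abs_on fa).
have xw0 : nonneg (x + w).
  by rewrite addrA; apply: pos (nonneg_abs_on _ _); case: mx.
have x'w0 : nonneg (x' + w).
  rewrite /w [abs_on tau x + _]addrC addrA.
  by apply: pos (nonneg_abs_on _ _); case: mx'.
have Sb : semigroup A (b + A *m w).
  by exists (x + w) => //; rewrite (mulmxDr A x w); case: mx => -[-> _] _.
have [v [_ vE]] := genc _ Sb.
have opt := group_minimizer_IP_optimal (group_minimizer_shift sw mx) xw0.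
have opt' := group_minimizer_IP_optimal (group_minimizer_shift sw mx') x'w0.
by apply: (addIr w); rewrite -(vE _ opt) -(vE _ opt').
Qed.

Lemma int_minimizer (T : Type) (P : T -> Prop) (f : T -> int) (m : int) x0 :
  P x0 -> (forall x, P x -> m <= f x) -> exists x, minimizer P f x.
Proof.
move=> Px0 mP; pose Q k := `[< exists2 x, P x & f x = m + k%:Z >].
have fE x : P x -> f x = m + `|f x - m|%N.
  by move=> Px; rewrite gez0_abs ?subr_ge0 ?mP // subrKC.
have exQ : exists k, Q k.
  by exists `|f x0 - m|%N; apply/asboolP; exists x0 => //; exact: fE.
case: (ex_minnP exQ) => k /asboolP[x Px fx] kmin; exists x; split=> // z Pz.
rewrite fx (fE z Pz) lerD2l lez_nat; apply: kmin.
by apply/asboolP; exists z => //; exact: fE.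
Qed.

(** * Optima along faces *)

Lemma toR_cost (R : realType) n (c : 'rV[int]_n) x :
  (cost c x)%:~R = (toR R c *m toR R x) 0 0.
Proof. by rewrite -map_mxM mxE. Qed.

Definition face_certificate (R : realType) (d n : nat) (A : 'M[int]_(d, n))
    (c : 'rV[int]_n) (sigma : {set 'I_n}) (y : 'rV[R]_d) : Prop :=
  forall j : 'I_n,
    if j \in sigma then (y *m toR R A) 0 j = toR R c 0 j
    else (y *m toR R A) 0 j < toR R c 0 j.

Lemma faceP (R : realType) d n (A : 'M[int]_(d, n)) c sigma :
  reflect (exists y : 'rV[R]_d, face_certificate A c sigma y)
          (sigma \in triangulation R A c).
Proof. by rewrite inE; exact: asboolP. Qed.

(** The sum pairs [x] with the slacks of the dual point [y]: this is weak
    duality as an identity. *)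
Lemma cost_slack (R : realType) d n (A : 'M[int]_(d, n)) c (y : 'rV[R]_d) x :
  (cost c x)%:~R = (y *m toR R (A *m x)) 0 0
                   + \sum_j (toR R c - y *m toR R A) 0 j * (x j 0)%:~R.
Proof.
have -> : \sum_j (toR R c - y *m toR R A) 0 j * (x j 0)%:~R =
          ((toR R c - y *m toR R A) *m toR R x) 0 0.
  by rewrite mxE; apply: eq_bigr => j _; rewrite [toR R x _ _]mxE.
rewrite toR_cost [toR R (A *m x)]map_mxM mulmxBl mulmxA mxE [in X in _ = X]mxE.
by rewrite addrC !mxE subrK.
Qed.

Lemma face_cost_ge (R : realType) d n (A : 'M[int]_(d, n)) c sigma
    (y : 'rV[R]_d) b x :
  face_certificate A c sigma y -> group_feasible A sigma b x ->
  (y *m toR R b) 0 0 <= (cost c x)%:~R.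
Proof.
move=> yP [Ax x0]; rewrite (cost_slack A c y) Ax lerDl sumr_ge0 // => j _.
have := yP j; rewrite !mxE; case: ifPn => [_ ->|js yj].
  by rewrite subrr mul0r.
by rewrite mulr_ge0 ?ler0z ?x0 // subr_ge0 ltW.
Qed.

Lemma face_cost_supported (R : realType) d n (A : 'M[int]_(d, n)) c sigma
    (y : 'rV[R]_d) x :
  face_certificate A c sigma y -> supported sigma x ->
  (cost c x)%:~R = (y *m toR R (A *m x)) 0 0.
Proof.
move=> yP sx; rewrite (cost_slack A c y) big1 ?addr0 // => j _.
have := yP j; rewrite !mxE; case: ifPn => [_ ->|js yj].
  by rewrite subrr mul0r.
by rewrite sx // mulr0.
Qed.

(** An integer cost bounded below on a non-empty set attains its minimum. *)
Lemma face_group_minimizer (R : realType) d n (A : 'M[int]_(d, n)) c sigma b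
    x0 :
  sigma \in triangulation R A c -> group_feasible A sigma b x0 ->
  exists x, group_minimizer A c sigma b x.
Proof.
move=> /faceP[y yP] fx0.
apply: (int_minimizer (m := Num.floor ((y *m toR R b) 0 0)) fx0) => x fx.
rewrite -(ler_int R); apply: le_trans (face_cost_ge yP fx).
exact: floor_le.
Qed.

(** On vectors supported on [sigma] the cost factors through [A], so [z] and [0]
    have the same cost and are both optimal for the right-hand side [0]. *)
Lemma face_kernel (R : realType) d n (A : 'M[int]_(d, n)) c sigma z :
  generic A c -> sigma \in triangulation R A c ->
  supported sigma z -> A *m z = 0 -> z = 0.
Proof.
move=> genc /faceP[y yP] sz Az.
have cost0 : cost c z = 0.
  apply: (@intr_inj R); rewrite (face_cost_supported yP sz) Az.
  by rewrite /toR map_mx0 mulmx0 mxE.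
have ge0 x : group_feasible A sigma 0 x -> 0 <= cost c x.
  move=> fx; rewrite -(ler_int R); apply: le_trans (face_cost_ge yP fx).
  by rewrite /toR map_mx0 mulmx0 mxE.
apply: (group_minimizer_unique (A := A) (c := c) (tau := sigma) (b := 0)) => //.
- split=> [|x /ge0]; last by rewrite cost0.
  by split=> [|j /sz ->].
- split=> [|x /ge0]; last by rewrite cost_0.
  by split=> [|j _]; rewrite ?mulmx0 ?mxE.
Qed.

(** * Independence of the columns in a face *)

Lemma clear_denominators m (v : 'cV[rat]_m) :
  exists2 k : int, k != 0 &
    exists z : 'cV[int]_m, map_mx intr z = k%:~R *: v.
Proof.
exists (\prod_i denq (v i 0)).
  by apply/prodf_neq0 => i _; exact: denq_neq0.
exists (\col_i (numq (v i 0) * \prod_(j | j != i) denq (v j 0))).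
apply/matrixP=> i j; rewrite !mxE (ord1 j).
rewrite [X in _ = X%:~R * _](bigD1 i) //= !intrM.
rewrite -[X in _ = _ * X](divq_num_den (v i 0)) [RHS]mulrC mulrA.
by rewrite mulfVK // intq_eq0 denq_neq0.
Qed.

(** Genericity only speaks of integer vectors.  Rank is invariant under field
    extension, so it suffices to exclude a rational relation between the
    columns; clearing denominators makes it an integer one. *)
Lemma face_cols_full (R : realType) d n (A : 'M[int]_(d, n)) c sigma :
  generic A c -> sigma \in triangulation R A c ->
  row_full (cols sigma (toR R A)).
Proof.
move=> genc sD; pose M : 'M[rat]_(d, #|sigma|) := map_mx intr (cols sigma A).
have -> : cols sigma (toR R A) = map_mx ratr M.
  by apply/matrixP => i j; rewrite !mxE ratr_int.
rewrite row_full_map /row_full -mxrank_tr; apply: inj_row_free => v.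
move=> /(congr1 trmx); rewrite trmx_mul trmxK trmx0 => Mv.
have [k k0 [z zE]] := clear_denominators v^T.
have Mz : cols sigma A *m z = 0.
  have /colP zM : map_mx intr (cols sigma A *m z) = 0 :> 'cV[rat]_d.
    by rewrite map_mxM /= zE -scalemxAr Mv scaler0.
  apply/colP => i; apply: (@intr_inj rat).
  by have := zM i; rewrite mxE => ->; rewrite !mxE.
(* [w] is [z] extended by zero outside [sigma]. *)
pose w : 'cV[int]_n := cols sigma 1%:M *m z.
have wE k' : w (enum_val k') 0 = z k' 0.
  rewrite mxE (bigD1 k') //= !mxE eqxx mul1r big1 ?addr0 // => i ik.
  by rewrite !mxE (inj_eq enum_val_inj) eq_sym (negbTE ik) mul0r.
have w0 : w = 0.
  apply: (face_kernel genc sD).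
    move=> j js; rewrite mxE big1 // => i _; rewrite !mxE.
    by case: eqP js => [->|_ _]; rewrite ?enum_valP // mul0r.
  by rewrite mulmxA /cols mulmx_colsub mulmx1.
have z0 : z = 0 by apply/colP => i; rewrite -wE w0 !mxE.
move: zE; rewrite z0 map_mx0 => /esym/eqP.
rewrite scaler_eq0 intq_eq0 (negbTE k0) /= => /eqP vT.
by rewrite -[v]trmxK vT trmx0.
Qed.

(** * Subfaces and extensions of faces *)

Lemma small_positive (R : realFieldType) (I : finType) (P : pred I)
    (s t : I -> R) :
  (forall j, P j -> 0 < s j) ->
  exists2 e, 0 < e & forall j, P j -> e * t j < s j.
Proof.
move=> s0; pose S := \sum_(j | P j) `|t j| / s j.
have S0 : 0 <= S.
  by apply: sumr_ge0 => j Pj; rewrite divr_ge0 // ltW ?s0.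
exists (1 + S)^-1 => [|j Pj]; first by rewrite invr_gt0 ltr_pwDl.
rewrite mulrC ltr_pdivrMr ?ltr_pwDl // -ltr_pdivrMl ?s0 // mulrC.
apply: le_lt_trans (_ : S < _); last by rewrite ltrDr.
apply: le_trans (_ : `|t j| / s j <= _).
  by rewrite ler_pM2r ?invr_gt0 ?s0 // ler_norm.
rewrite /S (bigD1 j) //= lerDl sumr_ge0 // => i /andP[Pi _].
by rewrite divr_ge0 // ltW ?s0.
Qed.

(** By independence of the columns, the certificate of [sigma] can be moved in a
    direction that keeps the equalities on [tau] and makes those on the rest of
    [sigma] strict; a small step preserves the strict inequalities. *)
Lemma subface (R : realType) d n (A : 'M[int]_(d, n)) c
    (sigma tau : {set 'I_n}) :
  generic A c -> sigma \in triangulation R A c -> tau \subset sigma ->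
  tau \in triangulation R A c.
Proof.
move=> genc sD /subsetP ts; have [y yP] := faceP _ _ _ _ sD.
pose v : 'rV[R]_#|sigma| := \row_k (if enum_val k \in tau then 0 else -1).
have [w wv] := submxP (submx_full v (face_cols_full genc sD)).
have wE j : j \in sigma -> (w *m toR R A) 0 j = if j \in tau then 0 else -1.
  move=> js; have := congr1 (fun r : 'rV_ _ => r 0 (enum_rank_in js j)) wv.
  by rewrite /cols mulmx_colsub !mxE enum_rankK_in.
have [e e0 eP] : exists2 e : R, 0 < e & forall j, j \notin sigma ->
    e * (w *m toR R A) 0 j < toR R c 0 j - (y *m toR R A) 0 j.
  apply: small_positive => j js; have := yP j.
  by rewrite (negbTE js) subr_gt0.
apply/faceP; exists (y + e *: w) => j.
have -> : ((y + e *: w) *m toR R A) 0 j =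
          (y *m toR R A) 0 j + e * (w *m toR R A) 0 j.
  by rewrite mulmxDl -scalemxAl mxE [X in _ + X]mxE.
have := yP j; have := wE j; have := eP j; have := ts j.
case: (j \in sigma) => [_ _ /(_ isT) -> ->|].
  by case: (j \in tau); rewrite ?mulr0 ?addr0 // mulrN1 ltrBlDr ltrDl.
case: (j \in tau) => [/(_ isT)//|_ /(_ isT) + _ _].
by rewrite ltrBrDl.
Qed.

(** Some direction [w] is orthogonal to the columns in [tau] but not to all
    columns.  Moving the certificate of [tau] along [w] until a first strict
    inequality becomes tight gives the certificate of a strictly larger face,
    of which [i |: tau] is a subface. *)
Lemma face_extension (R : realType) d n (A : 'M[int]_(d, n)) c
    (tau : {set 'I_n}) :
  generic A c -> \rank (toR R A) = d -> tau \in triangulation R A c ->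
  (#|tau| < d)%N ->
  exists2 i, i \notin tau & i |: tau \in triangulation R A c.
Proof.
move=> genc rkA tD lt_d; have [y yP] := faceP _ _ _ _ tD.
have [w w0 wt] : exists2 w : 'rV[R]_d, w != 0 & w *m cols tau (toR R A) = 0.
  have /rowV0Pn[w /sub_kermxP ? ?] : kermx (cols tau (toR R A)) != 0.
    rewrite kermx_eq0 /row_free neq_ltn.
    by rewrite (leq_ltn_trans (rank_leq_col _)).
  by exists w.
have wt0 j : j \in tau -> (w *m toR R A) 0 j = 0.
  move=> jt; have := congr1 (fun r : 'rV_ _ => r 0 (enum_rank_in jt j)) wt.
  by rewrite /cols mulmx_colsub !mxE enum_rankK_in.
have {w w0 wt wt0} [w wt0 [j0 wj0]] : exists2 w : 'rV[R]_d,
    forall j, j \in tau -> (w *m toR R A) 0 j = 0 &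
    exists j, 0 < (w *m toR R A) 0 j.
  have /rV0Pn[j] : w *m toR R A != 0.
    by rewrite mulmx_free_eq0 // /row_free rkA.
  rewrite neq_lt => /orP[wj|wj]; last by exists w => //; exists j.
  exists (- w) => [i it|]; first by rewrite mulNmx mxE wt0 ?oppr0.
  by exists j; rewrite mulNmx mxE oppr_gt0.
(* The slack [s] decreases at rate [t] along [w], so that constraint [j] becomes
   tight at time [s j / t j]. *)
pose t j := (w *m toR R A) 0 j; pose s j := toR R c 0 j - (y *m toR R A) 0 j.
have s0 j : j \notin tau -> 0 < s j.
  by move=> jt; have := yP j; rewrite (negbTE jt) subr_gt0.
have st0 j : j \in tau -> s j = 0.
  by move=> jt; have := yP j; rewrite jt /s => ->; rewrite subrr.
have [i ti0 imin] :=
  arg_minP (fun j => s j / t j) (wj0 : (fun j => 0 < t j) j0).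
have it : i \notin tau.
  by apply: contraTN ti0 => /wt0; rewrite /t => ->; rewrite ltxx.
set r := s i / t i in imin; have r0 : 0 < r by rewrite divr_gt0 ?s0.
have le_rt j : r * t j <= s j.
  have [tj|tj] := ltP 0 (t j); first by rewrite -ler_pdivlMr //; exact: imin.
  apply: le_trans (_ : 0 <= _); first by rewrite mulr_ge0_le0 // ltW.
  by have [/st0->|/s0/ltW] := boolP (j \in tau).
exists i => //; pose sigma := [set j | r * t j == s j].
apply: (@subface _ _ _ _ _ sigma) => //; last first.
  apply/subsetP => j; rewrite !inE => /orP[/eqP->|jt].
    by rewrite /r divfK // gt_eqF.
  by rewrite st0 // /t wt0 // mulr0.
apply/faceP; exists (y + r *: w) => j.
have -> : ((y + r *: w) *m toR R A) 0 j = (y *m toR R A) 0 j + r * t j.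
  by rewrite mulmxDl -scalemxAl mxE [X in _ + X]mxE.
rewrite inE; case: eqP => [->|/eqP ne]; first by rewrite addrC subrK.
by rewrite -ltrBrDl lt_neqAle ne le_rt.
Qed.

(** * The two forms of the group relaxation *)

Lemma minimizer_eq_order (T : Type) (K K' : numDomainType) (P : T -> Prop)
    (f : T -> K) (g : T -> K') x :
  (forall z z', P z -> P z' -> (f z <= f z') = (g z <= g z')) ->
  minimizer P f x <-> minimizer P g x.
Proof.
move=> fg; split=> -[Px mx]; split=> // z Pz.
  by rewrite -fg // mx.
by rewrite fg // mx.
Qed.

(** The certificate of [sigma] exhibits [c_sigma] in the row space of [A_sigma],
    where the partial inverse of [A_sigma] acts as an inverse. *)
Lemma reduced_cost_face (R : realType) d n (A : 'M[int]_(d, n)) c sigma j :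
  sigma \in triangulation R A c -> j \in sigma ->
  reduced_cost R A c sigma 0 j = 0.
Proof.
move=> /faceP[y yP] js.
have cE : cols sigma (toR R c) = y *m cols sigma (toR R A).
  apply/rowP => k; have := yP (enum_val k).
  by rewrite enum_valP /cols mulmx_colsub !mxE => ->.
rewrite /reduced_cost; set v := _ *m pinvmx _.
have : v *m cols sigma (toR R A) = cols sigma (toR R c).
  by rewrite /v mulmxKpV // cE submxMl.
move=> /(congr1 (fun r : 'rV_ _ => r 0 (enum_rank_in js j))).
rewrite /cols mulmx_colsub [LHS]mxE [RHS]mxE enum_rankK_in // => vj.
by rewrite mxE [X in _ + X]mxE vj subrr.
Qed.

(** The coordinates in [tau] can be added to the objective, their reduced costs
    being zero; the full sum is the cost minus a linear function of [A x]. *)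
Lemma group_optimalP (R : realType) d n (A : 'M[int]_(d, n)) c
    (sigma tau : {set 'I_n}) b x :
  sigma \in triangulation R A c -> tau \subset sigma ->
  group_optimal R A c sigma tau b x <-> group_minimizer A c tau b x.
Proof.
move=> sD /subsetP ts; apply: minimizer_eq_order => z z' [Az _] [Az' _].
pose y := cols sigma (toR R c) *m pinvmx (cols sigma (toR R A)).
suff fE u : A *m u = b ->
    \sum_(j in ~: tau) reduced_cost R A c sigma 0 j * (u j 0)%:~R =
    (cost c u)%:~R - (y *m toR R b) 0 0.
  by rewrite !fE // lerD2r ler_int.
move=> Au; rewrite (cost_slack A c y) Au [X in _ = X - _]addrC addrK.
rewrite [RHS](bigID [in ~: tau]) /=.
rewrite [X in _ = _ + X]big1 ?addr0 // => j; rewrite inE negbK => /ts js.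
by rewrite (reduced_cost_face sD js) mul0r.
Qed.

Lemma group_solvesP (R : realType) d n (A : 'M[int]_(d, n)) c tau b :
  generic A c -> tau \in triangulation R A c ->
  group_solves R A c tau b <->
  exists2 x, group_minimizer A c tau b x & nonneg x.
Proof.
move=> genc tD; split=> [sol|[x mx x0] sigma /maxsetp sD ts].
  have [sigma smax ts] := maxset_exists tD.
  have [x [mx _] x0] := sol _ smax ts.
  by exists x => //; apply/(group_optimalP _ _ (maxsetp smax) ts).
exists x => //; split; first exact/(group_optimalP _ _ sD ts).
by move=> z /(group_optimalP _ _ sD ts); exact: group_minimizer_unique.
Qed.

(** * The chain theorem *)

Theorem theorem5p2 (R : realType) (d n : nat) (A : 'M[int]_(d, n))
    (c : 'rV[int]_n)
    (rankA : \rank (toR R A) = d)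
    (pointedA : pointed (cone (R := R) A))
    (kerA : forall u : 'cV[R]_n, toR R A *m u = 0 -> nonneg u -> u = 0)
    (genc : generic A c)
    (tau : {set 'I_n})
    (assoc_tau : associated R A c tau)
    (tau_lt : (#|tau| < d)%N) :
  exists tau' : {set 'I_n},
    [/\ tau' \in triangulation R A c,
        associated R A c tau',
        tau \subset tau' &
        #|tau' :\: tau| = 1%N].
Proof.
have [tD [b [_ /(group_solvesP _ genc tD)[u mu u0] notsol]]] := assoc_tau.
pose F i := (i \notin tau) && (i |: tau \in triangulation R A c).
have fu s : group_feasible A s b u.
  by split; [case: mu => -[] | move=> j _; apply: u0].
have [x xP] : exists x : 'I_n -> 'cV[int]_n,
    forall i, F i -> group_minimizer A c (i |: tau) b (x i).
  suff /choice[x xP] : forall i,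
      exists x, F i -> group_minimizer A c (i |: tau) b x.
    by exists x.
  move=> i; have [/andP[_ iD]|nF] := boolP (F i); last by exists 0.
  by have [x mx] := face_group_minimizer iD (fu _); exists x.
(* Otherwise [x i] is feasible for the relaxation along [tau], hence equal to
   [u], and [i |: tau] solves the fiber of [b]. *)
have x_neg i : F i -> x i i 0 < 0.
  move=> Fi; have /andP[it iD] := Fi; rewrite ltNge; apply/negP => xi0.
  have mx := xP i Fi; have [[Ax x0] xmin] := mx.
  have xu : x i = u.
    apply: (group_minimizer_unique genc _ mu).
    split=> [|z fz].
      split=> // j jt; have [->//|ji] := eqVneq j i.
      by apply: x0; rewrite !inE negb_or ji.
    apply: le_trans (_ : cost c u <= _); first exact: xmin.
    by case: mu => _; apply.
  apply: (notsol _ iD); first by rewrite properUr // sub1set.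
  by apply/(group_solvesP _ genc iD); exists u; rewrite // -xu.
have [i0 i0t i0D] := face_extension genc rankA tD tau_lt.
have F0 : F i0 by apply/andP.
(* Largest, so that no [x j] is dearer than [x i]: along a larger face this
   contradicts the optimality of [x i]. *)
have [i Fi imax] := arg_maxP (fun i => cost c (x i)) F0.
have /andP[it iD] := Fi; exists (i |: tau); split; rewrite ?subsetUr //; last first.
  rewrite (_ : _ :\: _ = [set i]) ?cards1 //; apply/setP => j.
  by rewrite !inE; case: eqVneq => [->|_]; rewrite ?it ?andNb.
split=> //; set w := abs_on (i |: tau) (x i).
have mx := xP i Fi; have [fx xmin] := mx.
have sw : supported (i |: tau) w by exact: supported_abs_on.
have v0 : nonneg (x i + w) := nonneg_add_abs_on fx.
have mv := group_minimizer_shift sw mx.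
exists (b + A *m w); split.
- by exists (x i + w) => //; case: mv => -[].
- by apply/(group_solvesP _ genc iD); exists (x i + w).
move=> sigma sD /properP[sub [j js jnit]] /(group_solvesP _ genc sD)[v' mv' v'0].
have optv := group_minimizer_IP_optimal mv v0.
have optv' := group_minimizer_IP_optimal mv' v'0.
have Sb : semigroup A (b + A *m w) by exists (x i + w) => //; case: mv => -[].
have [v0' [_ uniqv]] := genc _ Sb.
have v'E : v' = x i + w by rewrite -(uniqv _ optv) -(uniqv _ optv').
(* Undo the translation: [x i] itself is optimal along [sigma]. *)
have sws : supported sigma (- w).
  by move=> k ks; rewrite mxE sw ?oppr0 //; apply: contra ks => /(subsetP sub).
have mxs := group_minimizer_shift sws mv'.
rewrite v'E mulmxN !addrK in mxs.
have /norP[ji jt] : ~~ ((j == i) || (j \in tau)) by move: jnit; rewrite !inE.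
have jD : j |: tau \in triangulation R A c.
  apply: subface genc sD _; rewrite subUset sub1set js.
  exact: subset_trans (subsetUr _ _) sub.
have Fj : F j by apply/andP.
have [[Axj xj0] _] := xP j Fj.
have fxj : group_feasible A sigma b (x j).
  split=> // k ks; apply: xj0; apply: contra ks; rewrite !inE.
  by case/orP=> [/eqP->//|kt]; apply: (subsetP sub); rewrite !inE kt orbT.
have mxj : group_minimizer A c sigma b (x j).
  by split=> // z fz; apply: le_trans (imax _ Fj) _; case: mxs => _; apply.
have := x_neg j Fj; rewrite (group_minimizer_unique genc mxj mxs) ltNge.
by case: fx => _ ->.
Qed.
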